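(* There is an algorithm that, given the $\mathcal{MRC}$ array of a string $w[1..n]$, correctly computes the compact representation $\mathcal{C}(w)$ of all $\mathcal{O}(n^2)$ closed substrings of $w$ in $\mathcal{O}(n\log n)$ time.
   Context: Strings are indexed from 1; $w[i..j]$ denotes the substring (occurrence) from position $i$ to $j$. A border of a string $x$ is a nonempty string that is both a proper prefix and a proper suffix of $x$. A string $x$ is closed if $|x|=1$, or $|x|\ge2$ and $x$ has a border occurring in $x$ only as a prefix and as a suffix and nowhere else. An occurrence $w[i..j]$ is maximal right-closed if it is closed and either $j=n$ or $w[i..j+1]$ is not closed. A closed occurrence $u=w[i..j]$ is right-extendible to a maximal right-closed occurrence $r=w[i..j']$ if $j<j'\le n$ and every prefix $w[i..k]$ of $r$ with $j<k<j'$ is closed. For a position $i$, let $r_1,\ldots,r_{K_i}$ be the maximal right-closed occurrences starting at $i$ with $|r_1|<\cdots<|r_{K_i}|$, let $b_j$ be the longest border of $r_j$ ($|b_j|=0$ if $|r_j|=1$), and let $p_j$ be the shortest closed prefix of $r_j$ such that $p_j=r_j$ or $p_j$ is right-extendible to $r_j$. The $\mathcal{MRC}$ array of $w$ is the array of length $n$ whose entry $\mathcal{MRC}[i]$ is the list of pairs $(|r_j|,|b_j|)$ for $j=K_i$ down to $1$. The compact representation is $\mathcal{C}(w)=\{(i,|p_j|,|r_j|)\mid 1\le i\le n,\ 1\le j\le K_i\}$; the closed substrings of $w$ are exactly the occurrences $w[i..i+\ell-1]$ with $(i,|p_j|,|r_j|)\in\mathcal{C}(w)$ and $|p_j|\le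 \ell\le |r_j|$. *)

(* Defs.v *)
From mathcomp Require Import all_boot.

Set Implicit Arguments.
Unset Strict Implicit.
Unset Printing Implicit Defensive.

Section Strings.
Variable T : eqType.
Implicit Types (b w x : seq T) (i j k l p : nat).

(* [w[i..j]], positions counted from 1; meaningful for 1 <= i <= j <= size w. *)
Definition substr w i j : seq T := take (j.+1 - i) (drop i.-1 w).

Definition border b x : bool :=
  [&& 0 < size b, size b < size x, prefix b x & suffix b x].

(* [b] occurs in [x] starting at position [p]. *)
Definition occurs_at b x p : bool :=
  [&& 0 < p, p + size b <= (size x).+1 & substr x p (p + size b).-1 == b].

Definition only_at_ends b x : bool :=
  all (fun p => occurs_at b x p ==> (p == 1) || (p == size x - size b + 1))
      (iota 1 (size x).+1).

Definition proper_prefixes x : seq (seq T) :=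
  [seq take l x | l <- iota 0 (size x)].

(* As a border is in particular a proper prefix, it suffices to search the
   proper prefixes; see [closed_stringP]. *)
Definition closed_string x : bool :=
  (size x == 1) ||
  (1 < size x) &&
    has (fun b => border b x && only_at_ends b x) (proper_prefixes x).

(* 0 if [x] has no border. *)
Definition longest_border_size x : nat :=
  \max_(b <- proper_prefixes x | border b x) size b.

Definition max_right_closed w i j : bool :=
  [&& 0 < i, i <= j, j <= size w, closed_string (substr w i j)
    & (j == size w) || ~~ closed_string (substr w i j.+1)].

(* [w[i..j]] is right-extendible to [w[i..j']]. *)
Definition right_extendible w i j j' : bool :=
  [&& 0 < i, i <= j, closed_string (substr w i j), max_right_closed w i j',
      j < j', j' <= size w
    & all (fun k => closed_string (substr w i k)) (iota j.+1 (j' - j.+1))].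

(* The end positions of r_1, ..., r_{K_i}, by increasing length. *)
Definition mrc_ends w i : seq nat :=
  [seq j <- iota i ((size w).+1 - i) | max_right_closed w i j].

Definition occ_size i j : nat := j.+1 - i.

Definition MRC_entry w i : seq (nat * nat) :=
  [seq (occ_size i j, longest_border_size (substr w i j))
     | j <- rev (mrc_ends w i)].

Definition MRC w : seq (seq (nat * nat)) :=
  [seq MRC_entry w i | i <- iota 1 (size w)].

(* For r = w[i..j], the end position of the shortest closed prefix p of r such
   that p = r or p is right-extendible to r; the default [j] is never used when
   r is maximal right-closed, since r itself is a candidate. *)
Definition shortest_end w i j : nat :=
  head j [seq e <- iota i (j.+1 - i)
            | closed_string (substr w i e)
              && ((e == j) || right_extendible w i e j)].

(* The triples (i, |p_j|, |r_j|). *)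
Definition compact w : seq (nat * nat * nat) :=
  [seq (i, occ_size i (shortest_end w i j), occ_size i j)
     | i <- iota 1 (size w), j <- mrc_ends w i].

(* The pairs (i, j) with 1 <= i <= j <= size w and w[i..j] closed. *)
Definition closed_occurrences w : seq (nat * nat) :=
  [seq ij <- [seq (i, j) | i <- iota 1 (size w), j <- iota i ((size w).+1 - i)]
     | closed_string (substr w ij.1 ij.2)].

Lemma closed_stringP x :
  reflect (size x = 1 \/
           1 < size x /\
           exists2 b, border b x &
             forall p, occurs_at b x p -> p = 1 \/ p = size x - size b + 1)
          (closed_string x).
Proof.
have endsP b : reflect
    (forall p, occurs_at b x p -> p = 1 \/ p = size x - size b + 1)
    (only_at_ends b x).
  apply: (iffP allP) => [H p pb|H p _].
    have /and3P[p0 ple _] := pb.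
    have /H : p \in iota 1 (size x).+1.
      by rewrite mem_iota p0 add1n ltnS (leq_trans (leq_addr _ _) ple).
    by rewrite pb => /orP[] /eqP ->; [left|right].
  by apply/implyP => /H[->|->]; rewrite eqxx ?orbT.
apply: (iffP orP) => -[/eqP ->|]; try by left.
  case/andP=> x1 /hasP[b _ /andP[bx /endsP be]].
  by right; split=> //; exists b.
case=> x1 [b bx /endsP be]; right; rewrite x1; apply/hasP; exists b; last first.
  by rewrite bx.
case/and4P: bx => _ bx; rewrite prefixE => /eqP pb _.
apply/mapP; exists (size b); last by rewrite pb.
by rewrite mem_iota.
Qed.

End Strings.

(* A RAM with registers and a random-access memory holding k-bit words, and a
   write-only output tape.  Registers and program addresses in an instruction
   are constants of the program. *)
Inductive instr : Type :=
| IConst of nat & nat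
| IAdd of nat & nat & nat
| ISub of nat & nat & nat
| ILoad of nat & nat
| IStore of nat & nat
| IPrint of nat
| IJumpPos of nat & nat.

Definition program := seq instr.

Record config := Config {
  pc : nat;
  reg : nat -> nat;
  mem : nat -> nat;
  out : seq nat
}.

Definition exec (k : nat) (ins : instr) (c : config) : config :=
  let: Config q r m o := c in
  match ins with
  | IConst d v => Config q.+1 [eta r with d |-> v %% 2 ^ k] m o
  | IAdd d a b => Config q.+1 [eta r with d |-> (r a + r b) %% 2 ^ k] m o
  | ISub d a b => Config q.+1 [eta r with d |-> (r a + 2 ^ k - r b) %% 2 ^ k] m o
  | ILoad d a => Config q.+1 [eta r with d |-> m (r a)] m o
  | IStore a s => Config q.+1 r [eta m with r a |-> r s] o
  | IPrint s => Config q.+1 r m (rcons o (r s))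
  | IJumpPos s t => Config (if 0 < r s then t else q.+1) r m o
  end.

(* The machine halts when the program counter leaves the program. *)
Definition halted (P : program) (c : config) : bool := size P <= pc c.

Definition step (k : nat) (P : program) (c : config) : config :=
  if onth P (pc c) is Some ins then exec k ins c else c.

(* The input occupies the memory from address 0; all else is 0. *)
Definition init (input : seq nat) : config :=
  Config 0 (fun=> 0) (nth 0 input) [::].

(* On word size k, P halts on [input] after at most t unit-cost steps, having
   printed [output]. *)
Definition runs_to (k : nat) (P : program) (input : seq nat) (t : nat)
    (output : seq nat) : Prop :=
  exists2 s, s <= t &
    let c := iter s (step k P) (init input) in halted P c /\ out c = output.

Definition encode_entry (e : seq (nat * nat)) : seq nat :=
  size e :: flatten [seq [:: q.1; q.2] | q <- e].

(* An array A of n lists of pairs: address 0 holds n, address i (1 <= i <= n)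
   holds the address of the block of A[i], and the blocks follow; each block is
   the length of the list followed by its pairs. *)
Definition encode_array (A : seq (seq (nat * nat))) : seq nat :=
  let blocks := [seq encode_entry e | e <- A] in
  let n := size A in
  n :: [seq n.+1 + sumn (take i (shape blocks)) | i <- iota 0 n]
    ++ flatten blocks.

Definition encode_triples (s : seq (nat * nat * nat)) : seq nat :=
  flatten [seq [:: t.1.1; t.1.2; t.2] | t <- s].

Definition bigO (f g : nat -> nat) : Prop :=
  exists c n0, forall n, n0 <= n -> f n <= c * g n.

(* Main.v *)
Require Import Defs.
From mathcomp Require Import all_boot zify.

Set Implicit Arguments.
Unset Strict Implicit.
Unset Printing Implicit Defensive.

(** For a suffix v of w, let d(m) be the distance at which the prefix of v of
    length m recurs first; d is nondecreasing, and the closed prefixes of v are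
    those of the lengths m + d(m), with longest border m (for m = 0, d = 1).
    The maximal right-closed prefixes are therefore the last ones with a given
    value of d, and consecutive ones satisfy
    |p_j| = |r_j| - |b_j| + |b_(j-1)| + 1, respectively |p_1| = |r_1| - |b_1|,
    so that a single scan of the MRC array yields C(w).

    The MRC array has O(n log n) entries: an entry with border length m is a
    pair of consecutive positions in a class of positions that agree on m
    letters, and these two positions are separated by the next letter, so one
    of them passes to a class of at most half the size, which happens to it at
    most log n times. *)

(** * First recurrences of prefixes and closed prefixes *)

Section Recurrence.
Variables (T : eqType) (v : seq T).
Implicit Types m d l : nat.

Definition recurs m d := (d + m <= size v) && (take m (drop d v) == take m v).

Definition first_recurs m d :=
  [&& 0 < d, recurs m d & all (fun d' => ~~ recurs m d') (iota 1 d.-1)].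

Lemma first_recursP m d :
  reflect [/\ 0 < d, recurs m d & forall d', 0 < d' < d -> ~~ recurs m d']
          (first_recurs m d).
Proof.
apply: (iffP and3P) => -[d0 rd /= H]; split=> //.
  move=> d' d'd; apply: (allP H); rewrite mem_iota; lia.
by apply/allP => d'; rewrite mem_iota => d'd; apply: H; lia.
Qed.

Lemma recursW m m' d : m <= m' -> recurs m' d -> recurs m d.
Proof.
move=> mm' /andP[dm /eqP e]; apply/andP; split; first lia.
by rewrite -(take_takel (drop d v) mm') e take_takel.
Qed.

Lemma first_recurs_ex m d : 0 < d -> recurs m d ->
  exists2 d', d' <= d & first_recurs m d'.
Proof.
move=> d0 rd; have ex : exists d, (0 < d) && recurs m d by exists d; rewrite d0.
case: (ex_minnP ex) => d' /andP[d'0 rd'] dmin; exists d'.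
  by apply: dmin; rewrite d0.
apply/first_recursP; split=> // e /andP[e0 ed]; apply/negP => re.
by have := dmin e; rewrite e0 re => /(_ isT); lia.
Qed.

Lemma first_recurs_le m m' d d' : m <= m' ->
  first_recurs m d -> first_recurs m' d' -> d <= d'.
Proof.
move=> mm' /first_recursP[_ _ dmin] /first_recursP[d'0 rd' _].
rewrite leqNgt; apply/negP => d'd; have := dmin d'; rewrite d'0 d'd.
by rewrite (recursW mm' rd') => /(_ isT).
Qed.

Lemma first_recurs_inj m d d' :
  first_recurs m d -> first_recurs m d' -> d = d'.
Proof.
by move=> h h'; apply/eqP; rewrite eqn_leq !(first_recurs_le (leqnn m)).
Qed.

Lemma first_recurs_size_le m m' d d' :
  first_recurs m d -> first_recurs m' d' -> m + d <= m' + d' -> m <= m'.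
Proof.
move=> h h' le; rewrite leqNgt; apply/negP => m'm.
by have := first_recurs_le (ltnW m'm) h' h; lia.
Qed.

(** Neither [m] nor [d] can decrease, and growth of [d] alone would give one [m] two first
    distances; so the unit of growth goes to [m]. *)
Lemma first_recurs_next m m' d d' :
  first_recurs m d -> first_recurs m' d' -> m' + d' = (m + d).+1 ->
  m' = m.+1 /\ d' = d.
Proof.
move=> h h' e; have mm' : m <= m' by apply: (first_recurs_size_le h h'); lia.
have dd' := first_recurs_le mm' h h'.
case: (eqVneq m m') => [mm|]; last by lia.
by move: h' e; rewrite -mm => /(first_recurs_inj h); lia.
Qed.

(** The empty prefix recurs at distance 1 already, so [m = 0] stands for the closed prefix of length
    1. *)
Lemma first_recurs0 d : first_recurs 0 d -> d = 1.
Proof.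
case/first_recursP=> d0 /andP[dv _] dmin; apply/eqP; rewrite eqn_leq d0 andbT.
rewrite leqNgt; apply/negP => d1; have := dmin 1; rewrite /recurs d1 !take0 eqxx.
by rewrite andbT => /(_ isT); lia.
Qed.

Lemma take_drop_take m d l : d + m <= l ->
  take m (drop d (take l v)) = take m (drop d v).
Proof. by move=> dml; rewrite !take_drop take_takel // addnC. Qed.

Lemma border_recurs b l : l <= size v -> border b (take l v) ->
  [/\ 0 < size b < l, b = take (size b) v & recurs (size b) (l - size b)].
Proof.
move=> lv /and4P[b0]; rewrite size_takel // => bl.
rewrite prefixE take_takel; last lia.
rewrite suffixE size_takel // => /eqP eb /eqP eb'; rewrite b0; split=> //.
rewrite /recurs subnK; last lia.
by rewrite lv /= take_drop subnKC; [rewrite eb eb' | lia].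
Qed.

Lemma occurs_at_take b l p : l <= size v -> 0 < p -> b = take (size b) v ->
  p.-1 + size b <= l -> occurs_at b (take l v) p = recurs (size b) p.-1.
Proof.
case: p => // p lv _ eb /= pl.
rewrite /occurs_at /recurs /substr size_takel //= -eb.
have -> : p.+1 + size b <= l.+1 = true by lia.
have -> : p + size b <= size v = true by lia.
by rewrite subSS addKn take_drop_take.
Qed.

(** A border of length [m] of the prefix of length [l] is a recurrence at distance [l - m]; it has
    no inner occurrence exactly when that recurrence is the first. *)
Lemma closed_takeP l : l <= size v ->
  reflect (exists2 md, l = md.1 + md.2 & first_recurs md.1 md.2)
          (closed_string (take l v)).
Proof.
move=> lv; apply: (iffP (closed_stringP _)); rewrite size_takel //.
- case=> [l1|[l1 [b bb bmin]]].
    exists (0, 1) => /=; first by rewrite l1.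
    apply/first_recursP; split=> // [|d']; last lia.
    by rewrite /recurs !take0 eqxx andbT -l1 addn0.
  have [/andP[b0 bl] eb rb] := border_recurs lv bb.
  exists (size b, l - size b); rewrite /= ?subnKC //; first lia.
  apply/first_recursP; split=> //; first by lia.
  move=> d d_lt; apply/negP => rd.
  have : occurs_at b (take l v) d.+1 by rewrite occurs_at_take //= ; lia.
  by move=> /bmin; lia.
- case=> -[[|m] d] /= -> h; first by left; rewrite (first_recurs0 h).
  have /first_recursP[d0 /andP[dv /eqP e] dmin] := h.
  have sb : size (take m.+1 v) = m.+1 by rewrite size_takel; lia.
  right; split; first lia.
  exists (take m.+1 v).
    rewrite /border sb size_takel; last lia.
    rewrite prefixE suffixE sb take_takel ?eqxx /=; last lia.
    rewrite size_takel; last lia.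
    by rewrite addKn -take_drop e eqxx andbT; lia.
  move=> p pb; have := pb; rewrite /occurs_at sb size_takel; last lia.
  case/and3P=> p0 ple _; move: pb.
  rewrite occurs_at_take ?sb //; [|lia..] => rp.
  case: (ltnP 1 p) => [p1|]; last by left; lia.
  right; case: (ltnP p.-1 d) => pd; last by lia.
  by have := dmin p.-1; rewrite rp => /(_ ltac:(lia)).
Qed.

(** A border longer than [m] would make the prefix of length [m] recur at a distance below [d]. *)
Lemma longest_border_size_take m d : first_recurs m d ->
  longest_border_size (take (m + d) v) = m.
Proof.
move=> h; have /first_recursP[d0 /andP[dv /eqP e] dmin] := h.
have lv : m + d <= size v by lia.
apply/eqP; rewrite eqn_leq; apply/andP; split.
  apply/bigmax_leqP_seq => b _ /(border_recurs lv)[bl _ rb].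
  rewrite leqNgt; apply/negP => mb.
  by have := dmin (m + d - size b); rewrite (recursW (ltnW mb) rb) => /(_ ltac:(lia)).
case: m h lv e dv {dmin} => // m h lv e dv.
have sb : size (take m.+1 v) = m.+1 by rewrite size_takel; lia.
rewrite -[X in X <= _]sb /longest_border_size.
  apply: (@leq_bigmax_seq _ _ (fun b => border b (take (m.+1 + d) v)) size (take m.+1 v)).
  apply/mapP; exists m.+1; last by rewrite take_takel // leq_addr.
  by rewrite mem_iota size_takel //; lia.
rewrite /border sb size_takel //.
rewrite prefixE suffixE sb size_takel // take_takel ?eqxx /=; last lia.
by rewrite addKn -take_drop e eqxx andbT; lia.
Qed.

End Recurrence.

(** * Runs of closed prefixes and the length of [p_j] *)

Section Entries.
Variables (T : eqType) (w : seq T).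
Implicit Types i j k e : nat.

Lemma max_right_closed_bounds i j : max_right_closed w i j ->
  0 < i <= j /\ j <= size w.
Proof. by case/and5P=> -> -> ->. Qed.

Lemma closed_substrP i j : 0 < i <= j -> j <= size w ->
  reflect (exists2 md, j.+1 - i = md.1 + md.2 &
             first_recurs (drop i.-1 w) md.1 md.2)
          (closed_string (substr w i j)).
Proof. by move=> ij jw; apply: closed_takeP; rewrite size_drop; lia. Qed.

Lemma closed_extend i j k : 0 < i -> i <= j < k -> k <= size w ->
  closed_string (substr w i j) ->
  (forall k', j <= k' < k -> ~~ max_right_closed w i k') ->
  forall k', j <= k' <= k -> closed_string (substr w i k').
Proof.
move=> i0 ijk kw cj nm k' /andP[jk']; rewrite -(subnKC jk').
elim: (k' - j) => [|t IH] lek; first by rewrite addn0.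
have c : closed_string (substr w i (j + t)) by apply: IH; lia.
rewrite addnS; apply/negPn/negP => nc.
have /negP[] : ~~ max_right_closed w i (j + t) by apply: nm; lia.
by apply/and5P; split=> //; [lia|lia|rewrite nc orbT].
Qed.

Lemma not_max_right_closed i j : j < size w ->
  closed_string (substr w i j.+1) -> ~~ max_right_closed w i j.
Proof.
move=> jw cj; apply/negP => /and5P[_ _ _ _]; rewrite cj orbF; lia.
Qed.

Lemma head_filter_iota_min (P : pred nat) x m n y :
  P y -> m <= y < m + n ->
  [/\ P (head x [seq z <- iota m n | P z]),
      m <= head x [seq z <- iota m n | P z]
    & head x [seq z <- iota m n | P z] <= y].
Proof.
move=> Py; elim: n m => [|n IH] m ymn /=; first lia.
case: ifP => Pm /=; first by split=> //; lia.
have ny : m != y by apply: contraFN Pm => /eqP->.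
by have [? ? ?] := IH m.+1 ltac:(lia); split=> //; lia.
Qed.

(** Right-extendibility asks that all prefixes in between be closed, so [p_j] starts the longest run
    of closed prefixes ending with [r_j]. *)
Lemma shortest_endP i j : max_right_closed w i j ->
  let e := shortest_end w i j in
  [/\ i <= e <= j,
      forall k, e <= k <= j -> closed_string (substr w i k)
    & forall k, i <= k <= j ->
        (forall k', k <= k' <= j -> closed_string (substr w i k')) -> e <= k].
Proof.
move=> mj e; have /and5P[i0 ij jw cj _] := mj.
set P := fun e => closed_string (substr w i e)
                  && ((e == j) || right_extendible w i e j).
have candP k : i <= k <= j ->
    (forall k', k <= k' <= j -> closed_string (substr w i k')) -> P k.
  move=> ikj ck; rewrite /P ck /=; last lia.
  case: eqP => //= kj; rewrite /right_extendible i0 mj jw ck /=; last lia.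
  apply/and3P; split; [lia|lia|].
  by apply/allP => k'; rewrite mem_iota => ?; apply: ck; lia.
have Pj : P j by rewrite /P cj eqxx.
have [Pe ie ej] := @head_filter_iota_min P j i (j.+1 - i) j Pj ltac:(lia).
rewrite -/(shortest_end w i j) -/e in Pe ie ej.
split; first by rewrite ie.
- move=> k /andP[ek kj]; case/andP: Pe => ce /orP[/eqP ej'|].
    by have -> : k = e by lia.
  case/and5P=> _ _ _ _ /and3P[_ _ /allP call].
  case: (ltngtP e k) ek => // [ek|<-] _; last by [].
  case: (ltngtP k j) kj => // [kj|->] _; last by [].
  by apply: call; rewrite mem_iota; lia.
- move=> k ikj ck; have Pk := candP k ikj ck.
  by have [] := @head_filter_iota_min P j i (j.+1 - i) k Pk ltac:(lia).
Qed.

(* The closed prefixes of a suffix are those of the lengths [m + d], where the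
   prefix of length [m] first recurs at distance [d]; [d] is constant from
   [p_j] to [r_j], and jumps from [r_(j-1)] to [p_j] while [m] grows by one. *)
Lemma shortest_end_prev i j : max_right_closed w i j ->
  let bs k := longest_border_size (substr w i k) in
  let p := occ_size i (shortest_end w i j) in
  ((forall k, max_right_closed w i k -> j <= k) /\ p = occ_size i j - bs j) \/
  exists k, [/\ k < j, max_right_closed w i k,
    forall k', max_right_closed w i k' -> k' < j -> k' <= k
    & p = occ_size i j - bs j + (bs k).+1].
Proof.
move=> mj bs p.
have [] := shortest_endP mj; rewrite {}/p; move: (shortest_end w i j) => e ej ce emin.
have /and5P[i0 ij jw cj _] := mj; rewrite /occ_size.
pose v := drop i.-1 w.
have cP k : i <= k <= size w -> closed_string (substr w i k) ->
    exists2 md, k.+1 - i = md.1 + md.2 & first_recurs v md.1 md.2.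
  by move=> ik /closed_substrP; apply; lia.
have bsE k m d : k.+1 - i = m + d -> first_recurs v m d -> bs k = m.
  by move=> E h; rewrite /bs /substr E longest_border_size_take.
have [[m d] /= Em hm] := cP j ltac:(lia) cj.
(* Going back from [j] to [e] through closed prefixes, each step lowers the border length by one and
   keeps [d]. *)
have chain t : t <= j - e -> t <= m /\ first_recurs v (m - t) d.
  elim: t => [|t IH] te; first by rewrite subn0.
  have [tm ht] := IH (ltnW te).
  have [[m' d'] /= Em' hm'] := cP (j - t.+1) ltac:(lia) (ce (j - t.+1) ltac:(lia)).
  have [] := first_recurs_next hm' ht; first by lia.
  by move=> mt ->; split; [lia|have -> : m - t.+1 = m' by lia].
have [tm he] := chain _ (leqnn _).
rewrite (bsE _ _ _ Em hm).
case: (ltnP i e) => ie; last first.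
  (* Here [e = i]: the run starts at length 1, so [d = 1] and no maximal right-closed occurrence is
     shorter. *)
  left; split; last first.
    have : m - (j - e) + d = 1 by lia.
    have /first_recursP[d0 _ _] := he; lia.
  move=> k mk; rewrite leqNgt; apply/negP => kj.
  have := max_right_closed_bounds mk => ik.
  by have := @not_max_right_closed i k ltac:(lia) (ce k.+1 ltac:(lia)); rewrite mk.
right.
have nce : ~~ closed_string (substr w i e.-1).
  apply/negP => c; suff: e <= e.-1 by lia.
  apply: emin; first lia.
  move=> k' ek'; case: (ltnP e.-1 k') => lt; first by apply: ce; lia.
  by have -> : k' = e.-1 by lia.
move: he; set me := m - _ => he.
have me0 : 0 < me.
  rewrite lt0n; apply/eqP => m0; move: he; rewrite m0 => /first_recurs0; lia.
have /first_recursP[d0 rd _] := he.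
have [d' d'd h'] := first_recurs_ex d0 (recursW (leq_pred me) rd).
have d'lt : d' < d.
  rewrite ltn_neqAle d'd andbT; apply/eqP => dd; case/negP: nce.
  by apply/closed_substrP; [lia..|exists (me.-1, d'); rewrite //=; lia].
have /first_recursP[d'0 _ _] := h'.
(* The closed prefix whose border is one shorter than at [e]; it turns out to be the predecessor
   [r_(j-1)]. *)
pose k := i + (me.-1 + d') - 1.
have Ek : k.+1 - i = me.-1 + d' by lia.
have kj : k < j by lia.
exists k; split=> //.
- apply/and5P; split; [by []|lia|lia| |].
    by apply/closed_substrP; [lia..|exists (me.-1, d')].
  apply/orP; right; apply/negP => c.
  have [[m2 d2] /= E2 h2] := cP k.+1 ltac:(lia) c.
  have [] := first_recurs_next h' h2; first lia.
  rewrite prednK // => m2e d2e; move: h2; rewrite m2e d2e => /(first_recurs_inj he); lia.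
(* A maximal end between [k] and [j] has border length at least [me], hence distance at least [d];
   so it lies in the run from [e] to [j], where only [j] is maximal. *)
- move=> k' mk' k'j; rewrite leqNgt; apply/negP => kk'.
  have /and5P[_ ik' k'w ck' _] := mk'; clear emin.
  have [[m2 d2] /= E2 h2] := cP k' ltac:(lia) ck'.
  have lt : me.-1 < m2.
    rewrite ltnNge; apply/negP => le; have := first_recurs_le le h2 h'; lia.
  have le : me <= m2 by lia.
  have dd2 := first_recurs_le le he h2.
  have ek' : e <= k' by lia.
  have ck : closed_string (substr w i k'.+1) by rewrite ce // leqW.
  by have := not_max_right_closed (leq_trans k'j jw) ck; rewrite mk'.
- by rewrite (bsE _ _ _ Ek h'); lia.
Qed.

End Entries.

(** * The number of maximal right-closed occurrences *)

Section Counting.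
Variables (T : eqType) (w : seq T).
Implicit Types x y m d : nat.

(** Positions count from 0. A suffix shorter than [m] is compared whole, so the end of the word acts
    as a letter of its own. *)
Definition same_prefix m x y := take m (drop x w) == take m (drop y w).

Definition class_size m x := count (same_prefix m x) (iota 0 (size w).+1).

Definition halves x m := (class_size m.+1 x).*2 <= class_size m x.

(* [(x, x + d)] are the consecutive occurrences of the prefix of length [m]
   that are separated by the next letter. *)
Definition separated (t : nat * nat * nat) :=
  let: (x, m, d) := t in
  [&& x <= size w, first_recurs (drop x w) m d
    & ~~ same_prefix m.+1 x (x + d)].

Lemma same_prefixW m m' x y : m <= m' -> same_prefix m' x y -> same_prefix m x y.
Proof.
move=> mm' /eqP e; apply/eqP.
by rewrite -(take_takel (drop x w) mm') e take_takel.
Qed.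

Lemma class_size_gt0 m x : x <= size w -> 0 < class_size m x.
Proof.
move=> xw; rewrite -has_count; apply/hasP; exists x; last exact: eqxx.
by rewrite mem_iota.
Qed.

Lemma count_halves x : x <= size w ->
  count (halves x) (iota 0 (size w).+1) <= trunc_log 2 (size w).+1.
Proof.
move=> xw; apply: trunc_log_max => //; set M := (X in iota 0 X).
(* Each halving doubles the power of two and at least halves the class, so the product never grows,
   while the class keeps containing [x]. *)
suff: 2 ^ count (halves x) (iota 0 M) * class_size M x <= (size w).+1.
  by apply: leq_trans; rewrite leq_pmulr // class_size_gt0.
elim: M => [|M IH].
  by rewrite mul1n (leq_trans (count_size _ _)) // size_iota.
have -> : iota 0 M.+1 = iota 0 M ++ [:: M] by rewrite -addn1 iotaD.
rewrite count_cat /= addn0; apply: leq_trans IH.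
have le : class_size M.+1 x <= class_size M x.
  by apply: sub_count => y; apply: same_prefixW.
case: (boolP (halves x M)) => [hM|_]; last by rewrite addn0 leq_mul2l le orbT.
by rewrite addn1 expnSr -mulnA mul2n leq_mul2l [_ <= _]hM orbT.
Qed.

Lemma separated_same x m d : first_recurs (drop x w) m d ->
  same_prefix m x (x + d).
Proof.
case/first_recursP=> _ /andP[_ /eqP e] _; apply/eqP.
by rewrite addnC -drop_drop e.
Qed.

(** The classes of the two positions for [m.+1] letters are disjoint parts of their common class for
    [m] letters, so one has at most half its size. *)
Lemma separated_halves x m d : separated (x, m, d) ->
  halves x m || halves (x + d) m.
Proof.
case/and3P=> xw h ns.
have sm := separated_same h.
have cE : class_size m (x + d) = class_size m x.
  by apply: eq_count => y; rewrite /same_prefix -(eqP sm).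
suff : class_size m.+1 x + class_size m.+1 (x + d) <= class_size m x.
  by rewrite /halves cE; lia.
rewrite /class_size -count_predUI -[X in _ <= X]addn0; apply: leq_add.
  apply: sub_count => y /orP[]; first exact: same_prefixW.
  by move/(same_prefixW (leqnSn m)); rewrite /same_prefix -(eqP sm).
rewrite leqn0 -leqn0 leqNgt -has_count; apply/hasPn => y _.
by apply/negP => /andP[/eqP ex /eqP ey]; case/negP: ns; rewrite /same_prefix ex ey.
Qed.

Lemma sumn_leq_size (I : eqType) (f : I -> nat) (s : seq I) (c : nat) :
  (forall z, z \in s -> f z <= c) -> sumn (map f s) <= size s * c.
Proof.
elim: s => //= x s IH fs; rewrite mulSn leq_add ?fs ?mem_head ?IH // => y ys.
by rewrite fs // inE ys orbT.
Qed.

Let halving := [seq (x, m) | x <- iota 0 (size w).+1,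
                  m <- [seq m <- iota 0 (size w).+1 | halves x m]].

Lemma size_halving :
  size halving <= (size w).+1 * trunc_log 2 (size w).+1.
Proof.
rewrite size_allpairs_dep -[X in X * _](size_iota 0).
apply: sumn_leq_size => x; rewrite mem_iota => /andP[_ xw].
by rewrite size_filter count_halves.
Qed.

Lemma mem_halving x m :
  x <= size w -> m <= size w -> halves x m -> (x, m) \in halving.
Proof.
move=> xw mw h; apply/allpairsPdep; exists x, m.
by rewrite mem_filter !mem_iota h !ltnS.
Qed.

(** If [x < x'], then [x'] carries the same [m] letters as the common right end, hence as [x], at a
    distance below [d]. *)
Lemma separated_inj x m d x' d' :
  separated (x, m, d) -> separated (x', m, d') -> x + d = x' + d' ->
  x <= x' -> x = x'.
Proof.
case/and3P=> xw h _; case/and3P=> x'w h' _ e.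
rewrite leq_eqVlt => /orP[/eqP//|lt].
have /first_recursP[d0 /andP[dm _] dmin] := h.
have /first_recursP[d'0 _ _] := h'.
have /negP[] : ~~ recurs (drop x w) m (x' - x) by apply: dmin; lia.
apply/andP; split; first by lia.
have := separated_same h'; rewrite -e /same_prefix => /eqP.
by rewrite -(eqP (separated_same h)) drop_drop (subnK (ltnW lt)) => ->.
Qed.

(* Each separated pair splits the class of the common prefix of length [m], so
   one of its two positions lands in a class of at most half the size; charge
   the pair to it.  A position is charged at most once per [m] in each role. *)
Lemma size_separated s : uniq s -> all separated s ->
  size s <= 2 * ((size w).+1 * trunc_log 2 (size w).+1).
Proof.
move=> us /allP ss.
pose a (t : nat * nat * nat) := halves t.1.1 t.1.2.
rewrite -(count_predC a) mul2n -addnn.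
have bnd t : separated t -> t.1.1 + t.2 <= size w /\ t.1.2 <= size w.
  case: t => -[x m] d /and3P[xw /first_recursP[d0 /andP[]]].
  by rewrite size_drop /=; lia.
apply: leq_add; rewrite -size_filter (leq_trans _ size_halving) //.
- rewrite -(size_map (fun t => t.1)); apply: uniq_leq_size.
    rewrite map_inj_in_uniq ?filter_uniq // => -[[x m] d] [[x' m'] d'].
    rewrite !mem_filter => /andP[_ /ss/and3P[_ h _]] /andP[_ /ss/and3P[_ h' _]].
    by case=> ex em; subst; rewrite (first_recurs_inj h h').
  move=> y /mapP[[[x m] d]]; rewrite mem_filter => /andP[h ts] ->.
  have [/= ? ?] := bnd _ (ss _ ts); apply: mem_halving => //; lia.
- rewrite -(size_map (fun t => (t.1.1 + t.2, t.1.2))); apply: uniq_leq_size.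
    rewrite map_inj_in_uniq ?filter_uniq // => -[[x m] d] [[x' m'] d'].
    rewrite !mem_filter => /andP[_ /ss h] /andP[_ /ss h'] [/= e em].
    subst m'; have ex : x = x'.
      case/orP: (leq_total x x') => le; first exact: separated_inj h h' e le.
      by apply/esym; apply: separated_inj h' h (esym e) le.
    by congr (_, _, _) => //; lia.
  move=> y /mapP[[[x m] d]]; rewrite mem_filter => /andP[/= h ts] ->.
  have [/= ? ?] := bnd _ (ss _ ts); apply: mem_halving => //.
  by case/orP: (separated_halves (ss _ ts)) => // hx; case/negP: h.
Qed.

(** Were the next letters equal, the border would grow to [m.+1] at the same distance and
    [w[i..j+1]] would be closed; if [j] is the last position, the right copy has no next letter. *)
Lemma max_right_closed_separated i j : max_right_closed w i j ->
  let m := longest_border_size (substr w i j) in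
  m <= occ_size i j /\ separated (i.-1, m, occ_size i j - m).
Proof.
move=> mj; have /and5P[i0 ij jw cj nj] := mj.
have /closed_substrP[|//|[m d] /= E h] := cj; first lia.
rewrite /substr E longest_border_size_take // /occ_size E leq_addr addKn.
split=> //; apply/and3P; split=> //; first lia.
have /first_recursP[d0 rd dmin] := h; move: rd => /andP[dm _].
rewrite size_drop in dm.
apply/negP => /eqP e.
have sz : d + m.+1 <= size w - i.-1.
  have := congr1 size e; rewrite !size_take_min !size_drop; lia.
case/orP: nj => [/eqP jE|/negP[]]; first by lia.
apply/closed_substrP; [lia|lia|exists (m.+1, d) => /=; first lia].
apply/first_recursP; split=> //.
  by rewrite /recurs size_drop sz drop_drop addnC -e /=.
by move=> d' /dmin; apply: contra; apply: recursW.
Qed.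

(** Starting position, border length and distance determine the occurrence, so the bound on
    separated pairs applies. *)
Lemma sum_size_mrc_ends :
  sumn [seq size (mrc_ends w i) | i <- iota 1 (size w)] <=
  2 * ((size w).+1 * trunc_log 2 (size w).+1).
Proof.
pose f i j := let m := longest_border_size (substr w i j) in
  (i.-1, m, occ_size i j - m).
rewrite -(size_allpairs_dep f); apply: size_separated.
  apply: allpairs_uniq_dep; first exact: iota_uniq.
    by move=> i _; rewrite filter_uniq // iota_uniq.
  move=> p q /allpairsPdep[i [j [i1 j1 ->]]] /allpairsPdep[i' [j' [i1' j1' ->]]] /=.
  rewrite mem_filter in j1; rewrite mem_filter in j1'.
  have [/andP[mj _] /andP[mj' _]] := (j1, j1').
  have [[b1 _] [b2 _]] := (max_right_closed_separated mj, max_right_closed_separated mj').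
  have [[ij _] [ij' _]] := (max_right_closed_bounds mj, max_right_closed_bounds mj').
  rewrite /f => -[ei em ed]; have ii' : i = i' by lia.
  subst i'; have -> // : j = j'.
  by move: ed b1 b2; rewrite -em /occ_size; lia.
apply/allP => y /allpairsPdep[i [j [_ + ->]]]; rewrite mem_filter.
by case/andP=> /max_right_closed_separated[].
Qed.

End Counting.

(** * The program *)

(* As the blocks are contiguous, one pointer (register 2) scans them all.
   Register 1 counts the remaining blocks, 3 holds i, 4 counts the remaining
   pairs of the block, and 7 accumulates |p_j|.  Comments give addresses. *)
Definition mrc_program : program :=
  [:: IConst 0 1;
      ILoad 1 2;
      IAdd 2 1 0;
      (* 3 *) IJumpPos 1 5;
      IJumpPos 0 27;
      IAdd 3 3 0;
      ISub 1 1 0;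
      ILoad 4 2;
      IAdd 2 2 0;
      (* 9 *) IJumpPos 4 11;
      IJumpPos 0 3;
      ISub 4 4 0;
      ILoad 5 2;
      IAdd 2 2 0;
      ILoad 6 2;
      IAdd 2 2 0;
      ISub 7 5 6;
      IJumpPos 4 19;
      IJumpPos 0 23;
      (* 19 *) IAdd 8 2 0;
      ILoad 8 8;
      IAdd 7 7 8;
      IAdd 7 7 0;
      (* 23 *) IPrint 3;
      IPrint 7;
      IPrint 5;
      IJumpPos 0 9].

(** As an MRC entry lists lengths in decreasing order, the head of the remaining list belongs to
    [r_(j-1)]; for [r_1] nothing is added. *)
Definition prev_border_succ (e : seq (nat * nat)) : nat :=
  if e is q :: _ then q.2.+1 else 0.

Fixpoint triples_of_entry (i : nat) (e : seq (nat * nat)) :=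
  if e is q :: e' then
    (i, q.1 - q.2 + prev_border_succ e', q.1) :: triples_of_entry i e'
  else [::].

Lemma modn_subr N a b : b <= a -> a < N -> (a + N - b) %% N = a - b.
Proof.
move=> ba aN; rewrite addnC -addnBA // addnC modnDr modn_small //.
exact: leq_ltn_trans (leq_subr _ _) aN.
Qed.

Lemma nth_drop_eq (s : seq nat) a i t :
  drop a s = t -> nth 0 s (a + i) = nth 0 t i.
Proof. by move=> <-; rewrite nth_drop. Qed.

Lemma stepE k q r m o : q < size mrc_program ->
  step k mrc_program (Config q r m o) =
  exec k (nth (IPrint 0) mrc_program q) (Config q r m o).
Proof. by rewrite /step onthE => lt_q; rewrite (nth_map (IPrint 0)). Qed.

(* The configuration is matched syntactically: left to [rewrite], unification
   would execute the inner steps in order to rewrite the outermost one. *)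
Ltac run_step := match goal with
  |- context [step ?k mrc_program (Config ?q ?r ?m ?o)] =>
    rewrite (@stepE k q r m o) //=
  end.

(** * Execution on the encoded array *)

Section Run.
Variables (k : nat) (input : seq nat) (n : nat).
(** Addresses up to the end of the input and the largest computed value,
    [|r_j| - |b_j| + |b_(j-1)| + 1 <= 2n + 1], fit in a word, so the arithmetic does not wrap
    around. *)
Hypothesis input_small : size input < 2 ^ k.
Hypothesis n_small : n.*2.+1 < 2 ^ k.
Let run s r q o := iter s (step k mrc_program) (Config q r (nth 0 input) o).

Definition small_entry (e : seq (nat * nat)) :=
  all (fun q : nat * nat => q.2 <= q.1 <= n) e.

Definition flat_pairs (e : seq (nat * nat)) :=
  flatten [seq [:: q.1; q.2] | q <- e].

Lemma size_flat_pairs e : size (flat_pairs e) = (size e).*2.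
Proof. by elim: e => //= q e IH; rewrite doubleS -IH. Qed.

Lemma run_pair i q e rest r o :
  small_entry (q :: e) ->
  r 0 = 1 -> r 3 = i -> r 4 = (size e).+1 ->
  drop (r 2) input = flat_pairs (q :: e) ++ rest ->
  exists s r', [/\ s <= 16,
    run s r 9 o = Config 9 r' (nth 0 input)
      (o ++ encode_triples [:: (i, q.1 - q.2 + prev_border_succ e, q.1)]),
    [/\ r' 0 = 1, r' 1 = r 1, r' 3 = i & r' 4 = size e] &
    drop (r' 2) input = flat_pairs e ++ rest].
Proof.
case: q => a b /andP[/andP[ba an] se] r0 r3 r4.
have -> : flat_pairs ((a, b) :: e) ++ rest =
  [:: a, b & flat_pairs e ++ rest] by [].
move=> Hd.
have {}ba : b <= a := ba; have {}an : a <= n := an.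
have H0 : nth 0 input (r 2) = a by rewrite -[r 2]addn0 (nth_drop_eq _ Hd).
have H1 : nth 0 input (r 2).+1 = b by rewrite -addn1 (nth_drop_eq _ Hd).
have H3 : nth 0 input (r 2).+3 = nth 0 (flat_pairs e ++ rest) 1.
  by rewrite -addn3 (nth_drop_eq _ Hd).
have Hsz : r 2 + ((size e).*2.+2 + size rest) = size input.
  have := congr1 size Hd; rewrite size_drop /= size_cat size_flat_pairs; lia.
have HD : drop (r 2).+2 input = flat_pairs e ++ rest.
  by rewrite -addn2 addnC -drop_drop Hd /= drop0.
have [r1 [run1 [[s0 s1 s2 s3] [s4 s5 s7]]]] :
    exists r1, iter 7 (step k mrc_program) (Config 9 r (nth 0 input) o) =
      Config 17 r1 (nth 0 input) o /\
    [/\ r1 0 = 1, r1 1 = r 1, r1 2 = (r 2).+2 & r1 3 = i] /\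
    [/\ r1 4 = size e, r1 5 = a & r1 7 = a - b].
  eexists; split.
    rewrite /=; run_step; rewrite r4 /=.
    by do 6! run_step.
  rewrite /= r0 r4.
  have m2 x : x <= 2 -> (r 2 + x) %% 2 ^ k = r 2 + x.
    by move=> ?; rewrite modn_small //; lia.
  have [a_small ek] : a < 2 ^ k /\ (size e).+1 < 2 ^ k by lia.
  by rewrite (m2 1) // H0 -addnA m2 // [r 2 + 1]addn1 addn2 H1 !modn_subr ?subn1 //.
have {se}: small_entry e by [].
(* For the last pair the program jumps to 23; otherwise register 8 is made to point to the border
   length of the next pair. *)
case: e HD s4 H3 Hsz {Hd r4} => [|[a' b'] e] HD s4 H3 Hsz se.
  exists (6 + 7); eexists; split=> //.
  - rewrite /run iterD run1 /=.
    run_step; rewrite s4 /=.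
    run_step; rewrite s0 /=.
    do 3! run_step.
    by run_step; rewrite s0 /= s3 s5 s7 -!cats1 -!catA /= addn0.
  - by rewrite s1.
  - by rewrite s2.
case/andP: se => /andP[ba' an'] _.
have {}ba' : b' <= a' := ba'; have {}an' : a' <= n := an'.
exists (9 + 7); eexists; split=> //.
- rewrite /run iterD run1 /=.
  run_step; rewrite s4 /=.
  do 7! run_step.
  run_step; rewrite s0 /= s3 s5 s7 s2 [(r 2).+2 + 1]addn1.
  have Haddr : ((r 2).+3) %% 2 ^ k = (r 2).+3.
    by rewrite modn_small //; move: Hsz => /=; lia.
  have -> : ((a - b + nth 0 input ((r 2).+3 %% 2 ^ k)) %% 2 ^ k + 1) %% 2 ^ k
      = a - b + b'.+1.
    rewrite Haddr H3 -[nth 0 _ _]/(b') [(a - b + b') %% _]modn_small; last lia.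
    by rewrite modn_small; lia.
  by rewrite -!cats1 -!catA.
- by rewrite /= s1.
- by rewrite /= s2.
Qed.

Lemma run_entry i e rest r o :
  small_entry e -> r 0 = 1 -> r 3 = i -> r 4 = size e ->
  drop (r 2) input = flat_pairs e ++ rest ->
  exists s r', [/\ s <= 16 * size e + 2,
    run s r 9 o = Config 3 r' (nth 0 input)
      (o ++ encode_triples (triples_of_entry i e)),
    [/\ r' 0 = 1, r' 1 = r 1 & r' 3 = i] & drop (r' 2) input = rest].
Proof.
elim: e r o => [|q e IH] r o se r0 r3 r4 Hd.
  exists 2, r; split=> //; rewrite /run /=.
  run_step; rewrite r4 /=.
  by run_step; rewrite r0 /= cats0.
have [s1 [r1 [s1le run1 [r10 r11 r13 r14] Hd1]]] := run_pair o se r0 r3 r4 Hd.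
have se' : small_entry e by case/andP: se.
have [s2 [r2 [s2le run2 [r20 r21 r23] Hd2]]] := IH _
  (o ++ encode_triples [:: (i, q.1 - q.2 + prev_border_succ e, q.1)]) se' r10 r13 r14 Hd1.
exists (s2 + s1), r2; split=> //; last by rewrite r21 r11.
  by rewrite /= mulnS; lia.
rewrite /run iterD; move: run1 run2; rewrite /run => -> ->.
by rewrite -catA.
Qed.

Fixpoint triples_of_array (i : nat) (A : seq (seq (nat * nat))) :=
  if A is e :: A' then triples_of_entry i.+1 e ++ triples_of_array i.+1 A'
  else [::].

(** In each block, 5 steps read the header and 2 leave it; the final 2 leave the outer loop. *)
Lemma run_array i A r o :
  all small_entry A -> i + size A <= n ->
  r 0 = 1 -> r 1 = size A -> r 3 = i ->
  drop (r 2) input = flatten [seq encode_entry e | e <- A] ->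
  exists s r', s <= \sum_(e <- A) (16 * size e + 7) + 2 /\
    run s r 3 o = Config 27 r' (nth 0 input)
      (o ++ encode_triples (triples_of_array i A)).
Proof.
elim: A i r o => [|e A IH] i r o sA iA r0 r1 r3 Hd.
  exists 2, r; rewrite big_nil; split=> //; rewrite /run /=.
  run_step; rewrite r1 /=.
  by run_step; rewrite r0 /= cats0.
case/andP: sA => se sA.
have Hsz : r 2 < size input.
  by rewrite ltnNge; apply/negP => /drop_oversize; rewrite Hd.
have H0 : nth 0 input (r 2) = size e by rewrite -[r 2]addn0 (nth_drop_eq _ Hd).
have HD : drop (r 2).+1 input = flat_pairs e ++ flatten [seq encode_entry e | e <- A].
  by rewrite -addn1 addnC -drop_drop Hd /= drop0.
rewrite /= in iA r1.
have [r' [run1 [s0 s1 s2] [s3 s4]]] :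
    exists r', [/\ run 5 r 3 o = Config 9 r' (nth 0 input) o,
    [/\ r' 0 = 1, r' 1 = size A & r' 2 = (r 2).+1] & r' 3 = i.+1 /\ r' 4 = size e].
  eexists; split.
  - rewrite /run /=; run_step; rewrite r1 /=.
    by do 4! run_step.
  - rewrite /= r0 r1 modn_subr ?subn1 //; last lia.
    by rewrite addn1 modn_small //; lia.
  by rewrite /= H0 r0 r3 addn1 modn_small //; lia.
rewrite -s2 in HD.
have [t1 [r2 [t1le run2 [r20 r21 r23] HD2]]] := run_entry o se s0 s3 s4 HD.
have [] := IH i.+1 r2 (o ++ encode_triples (triples_of_entry i.+1 e)) => //.
  by rewrite addSnnS.
  by rewrite r21.
move=> t2 [r3' [t2le run3]].
exists (t2 + (t1 + 5)), r3'; rewrite big_cons; split; first by lia.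
rewrite /run !iterD; move: run1 run2 run3; rewrite /run => -> -> ->.
by rewrite -catA /encode_triples /= map_cat flatten_cat.
Qed.

End Run.

Lemma run_mrc_program k n A :
  all (small_entry n) A -> size A <= n ->
  size (encode_array A) < 2 ^ k -> n.*2.+1 < 2 ^ k ->
  runs_to k mrc_program (encode_array A) (\sum_(e <- A) (16 * size e + 7) + 5)
    (encode_triples (triples_of_array 0 A)).
Proof.
move=> sA An szk nk.
set input := encode_array A.
have Hd : drop (size A).+1 input = flatten [seq encode_entry e | e <- A].
  by rewrite /input /encode_array /= drop_size_cat // size_map size_iota.
have [r [run1 [r0 r1 r2 r3]]] : exists r,
    iter 3 (step k mrc_program) (init input) = Config 3 r (nth 0 input) [::] /\
    [/\ r 0 = 1, r 1 = size A, r 2 = (size A).+1 & r 3 = 0].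
  eexists; split; first by rewrite /init /=; do 3! run_step.
  rewrite /= !modn_small; [by rewrite addn1| lia..].
rewrite -r2 in Hd.
have := @run_array _ _ _ szk nk 0 _ _ [::] sA An r0 r1 r3 Hd.
move=> [s [r' [sle run2]]].
exists (s + 3); first lia.
by rewrite iterD run1 run2.
Qed.

(** * Correctness and running time *)

Section Main.
Variables (T : eqType) (w : seq T).
Implicit Types i j k : nat.

Lemma mem_mrc_ends i j : 0 < i -> (j \in mrc_ends w i) = max_right_closed w i j.
Proof.
move=> i0; rewrite mem_filter mem_iota.
case: (boolP (max_right_closed w i j)) => //.
by move=> /max_right_closed_bounds; lia.
Qed.

Lemma triples_of_MRC_entry i : 0 < i ->
  triples_of_entry i (MRC_entry w i) =
  [seq (i, occ_size i (shortest_end w i j), occ_size i j)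
     | j <- rev (mrc_ends w i)].
Proof.
move=> i0; rewrite /MRC_entry.
have : sorted gtn (rev (mrc_ends w i)).
  rewrite rev_sorted; apply: sorted_filter; last exact: iota_ltn_sorted.
  by move=> x y z; apply: ltn_trans.
have : forall j, j \in rev (mrc_ends w i) -> max_right_closed w i j.
  by move=> j; rewrite mem_rev mem_mrc_ends.
(* This downward closure passes to the tails of the list, and so keeps the predecessor of [j]
   available in the induction. *)
have : forall j k, j \in rev (mrc_ends w i) -> max_right_closed w i k -> k < j ->
    k \in rev (mrc_ends w i).
  by move=> j k _; rewrite mem_rev mem_mrc_ends.
elim: (rev _) => //= j s IH down mrc srt.
have lt_j k : k \in s -> k < j.
  have tr : transitive gtn by move=> x y z /= xy /ltn_trans; apply.
  by move: k; apply/allP; apply: order_path_min srt.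
rewrite -IH; last first.
- exact: path_sorted srt.
- by move=> k ks; apply: mrc; rewrite inE ks orbT.
- move=> k k' ks mk' lt; have := down k k'; rewrite !inE ks orbT.
  by move=> /(_ isT mk' lt) /orP[/eqP e|//]; have := lt_j _ ks; lia.
congr (_ :: _); congr (_, _, _).
have mj : max_right_closed w i j by apply: mrc; rewrite mem_head.
have [[jmin ->]|[k [kj mk kmax ->]]] := shortest_end_prev mj.
  case: s lt_j mrc {IH down srt} => [|h s] lt_j mrc; first by rewrite addn0.
  have := jmin h; rewrite mrc ?inE ?eqxx ?orbT // => /(_ isT).
  by have := lt_j h; rewrite mem_head => /(_ isT); lia.
(* The predecessor [k] lies in the decreasing tail and is its largest element, hence its head. *)
have : k \in s.
  by have := down j k; rewrite !inE eqxx => /(_ isT mk kj) /orP[/eqP|//]; lia.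
case: s lt_j mrc srt {IH down} => [|h s] //= lt_j mrc /andP[_ srt].
have mh : max_right_closed w i h by apply: mrc; rewrite !inE eqxx orbT.
have hk := kmax h mh (lt_j h (mem_head _ _)).
rewrite inE => /orP[/eqP -> //|ks].
have tr : transitive gtn by move=> x y z /= xy /ltn_trans; apply.
have /allP/(_ k ks) /= := order_path_min tr srt; lia.
Qed.

Definition triples := triples_of_array 0 (MRC w).

Lemma triplesE : triples =
  [seq (i, occ_size i (shortest_end w i j), occ_size i j)
     | i <- iota 1 (size w), j <- rev (mrc_ends w i)].
Proof.
rewrite /triples /MRC; elim: (size w) 0 => //= n IH i.
by rewrite IH triples_of_MRC_entry.
Qed.

Lemma mem_triples : triples =i compact w.
Proof.
move=> t; rewrite triplesE; apply/allpairsPdep/allpairsPdep => -[i [j [ii jj ->]]];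
  by exists i, j; rewrite mem_rev in jj *.
Qed.

Lemma uniq_triples : uniq triples.
Proof.
rewrite triplesE; apply: allpairs_uniq_dep; first exact: iota_uniq.
  by move=> i _; rewrite rev_uniq filter_uniq // iota_uniq.
move=> p q /allpairsPdep[i [j [ii jj ->]]] /allpairsPdep[i' [j' [ii' jj' ->]]] /=.
case=> e _; subst i' => e.
rewrite mem_iota in ii; rewrite !mem_rev !mem_mrc_ends in jj jj'; try lia.
have [[ij _] [ij' _]] := (max_right_closed_bounds jj, max_right_closed_bounds jj').
by have -> : j = j' by move: e; rewrite /occ_size; lia.
Qed.

(** * Closed substrings and the compact representation *)

Lemma max_right_closed_above i j : 0 < i <= j -> j <= size w ->
  closed_string (substr w i j) ->
  exists2 k, j <= k & max_right_closed w i k /\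
    forall k', j <= k' <= k -> closed_string (substr w i k').
Proof.
move=> ij jw cj.
have ex : exists k, (j <= k) && ((k == size w) || max_right_closed w i k).
  by exists (size w); rewrite jw eqxx.
case: (ex_minnP ex) => k /andP[jk mk] kmin.
have kw : k <= size w by apply: kmin; rewrite jw eqxx.
have cl : forall k', j <= k' <= k -> closed_string (substr w i k').
  case: (ltnP j k) => [jk'|kj]; last by move=> k' ?; have -> : k' = j by lia.
  apply: closed_extend => //; [lia|lia|].
  move=> k' /andP[jk1 kk']; apply/negP => mk'.
  by have := kmin k'; rewrite jk1 mk' orbT => /(_ isT); lia.
exists k => //; split=> //; case/orP: mk => // /eqP kE.
by apply/and5P; split; rewrite ?kE ?eqxx //; [lia|lia|apply: cl; lia].
Qed.

Lemma mem_closed_occurrences i j :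
  ((i, j) \in closed_occurrences w) =
  [&& 0 < i, i <= j, j <= size w & closed_string (substr w i j)].
Proof.
rewrite mem_filter /= andbC.
have -> : (i, j) \in [seq (i, j) | i <- iota 1 (size w), j <- iota i ((size w).+1 - i)]
    = [&& 0 < i, i <= j & j <= size w].
  apply/allpairsPdep/and3P => [[i' [j' []]]|[? ? ?]].
    by rewrite !mem_iota => ? ? [-> ->]; split; lia.
  by exists i, j; rewrite !mem_iota; split=> //; lia.
by rewrite -!andbA.
Qed.

Lemma closed_occurrences_compact i l : 0 < l ->
  (i, i + l - 1) \in closed_occurrences w <->
  exists p r, (i, p, r) \in compact w /\ p <= l <= r.
Proof.
move=> l0; rewrite mem_closed_occurrences; split.
  move=> /and4P[i0 ij jw cj].
  have [k jk [mk ck]] := max_right_closed_above (introT andP (conj i0 ij)) jw cj.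
  exists (occ_size i (shortest_end w i k)), (occ_size i k); split.
    apply/allpairsPdep; exists i, k; rewrite mem_mrc_ends // mem_iota; split=> //.
    lia.
  have [eb ce emin] := shortest_endP mk.
  have ek : shortest_end w i k <= i + l - 1 by apply: emin; [lia|].
  by rewrite /occ_size; lia.
case=> p [r [/allpairsPdep[i' [k [ii kk [-> -> ->]]]] prl]].
rewrite mem_iota in ii; rewrite mem_mrc_ends in kk; last lia.
have [eb ce _] := shortest_endP kk; have [ik kw] := max_right_closed_bounds kk.
move: prl; rewrite /occ_size => prl.
by apply/and4P; split; [lia..|apply: ce; lia].
Qed.

Lemma size_closed_occurrences : size (closed_occurrences w) <= size w ^ 2.
Proof.
rewrite size_filter (leq_trans (count_size _ _)) // size_allpairs_dep.
rewrite -mulnn -[X in X * _](size_iota 1); apply: sumn_leq_size => i.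
by rewrite mem_iota size_iota; lia.
Qed.

Lemma MRC_entry_small i : 0 < i -> small_entry (size w) (MRC_entry w i).
Proof.
move=> i0; apply/allP => q /mapP[j]; rewrite mem_rev mem_mrc_ends // => mj -> /=.
have [-> _] := max_right_closed_separated mj.
by have [] := max_right_closed_bounds mj; rewrite /occ_size; lia.
Qed.

(** At most 16 steps for each pair, whose number [sum_size_mrc_ends] bounds, 7 for each block, and 5
    to start and to leave the outer loop. *)
Definition mrc_time n := 16 * (2 * (n.+1 * trunc_log 2 n.+1)) + 7 * n + 5.

Lemma run_MRC k : 2 * (size (encode_array (MRC w))).+1 <= 2 ^ k ->
  runs_to k mrc_program (encode_array (MRC w)) (mrc_time (size w))
    (encode_triples triples).
Proof.
move=> hk.
have sM : size (MRC w) = size w by rewrite size_map size_iota.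
have [s sle H] : runs_to k mrc_program (encode_array (MRC w))
   (\sum_(e <- MRC w) (16 * size e + 7) + 5) (encode_triples triples).
  apply: (@run_mrc_program _ (size w)); rewrite ?sM //; try lia.
    apply/allP => e /mapP[i]; rewrite mem_iota => ii ->; apply: MRC_entry_small; lia.
  (* The encoding has at least [n + 1] words, so the factor 2 makes [2n + 1] fit in a word. *)
  move: hk; rewrite /= size_cat size_map size_iota sM; lia.
exists s => //; apply: leq_trans sle _.
rewrite /mrc_time leq_add2r big_split /= -big_distrr /=.
apply: leq_add; last by rewrite big_const_seq count_predT iter_addn addn0 sM.
rewrite leq_mul2l /= big_map (leq_trans _ (sum_size_mrc_ends w)) //.
by rewrite sumnE big_map; apply: leq_sum => i _; rewrite size_map size_rev.
Qed.

End Main.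

Lemma mrc_time_bigO : bigO mrc_time (fun n => n * trunc_log 2 n).
Proof.
(* From 2 on the logarithm is positive, which absorbs the linear terms and the passage from [n] to
   [n.+1]. *)
exists 140, 2 => n n2; rewrite /mrc_time.
have l1 : 0 < trunc_log 2 n by rewrite trunc_log_gt0.
have : trunc_log 2 n.+1 <= (trunc_log 2 n).+1.
  by rewrite -[X in _ <= X](@trunc_expnK 2) // leq_trunc_log // trunc_log_ltn.
move: (trunc_log 2 n) (trunc_log 2 n.+1) l1 => l l' l1 ll'; nia.
Qed.

Theorem theorem4 :
  exists (P : program) (a : nat) (time nocc : nat -> nat),
    [/\ bigO time (fun n => n * trunc_log 2 n),
        bigO nocc (fun n => n ^ 2)
      & forall (T : eqType) (w : seq T),
        [/\ (* there are O(n^2) closed substrings *)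
            size (closed_occurrences w) <= nocc (size w),
            (* C(w) represents exactly the closed substrings *)
            forall i l : nat, 0 < l ->
              ((i, i + l - 1) \in closed_occurrences w) <->
              (exists p r : nat, (i, p, r) \in compact w /\ p <= l <= r)
          & (* P computes C(w), listed without repetition, from the MRC array,
               on every word size large enough to address memory that is
               linear in the input *)
            forall k : nat,
              a * (size (encode_array (MRC w))).+1 <= 2 ^ k ->
              exists s : seq (nat * nat * nat),
                [/\ uniq s, s =i compact w
                  & runs_to k P (encode_array (MRC w)) (time (size w))
                      (encode_triples s)]]].
Proof.
exists mrc_program, 2, mrc_time, (expn^~ 2); split.
- exact: mrc_time_bigO.
- by exists 1, 0 => n _; rewrite mul1n.
move=> T w; split.
- exact: size_closed_occurrences.
- exact: closed_occurrences_compact.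
move=> k hk; exists (triples w); split.
- exact: uniq_triples.
- exact: mem_triples.
- exact: run_MRC.
Qed.
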